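(* Let $R=k[[x_1,\dots,x_n]]$ with maximal ideal $\mathfrak m$, and let $I\subset R$ be an ideal extended from a homogeneous ideal of $k[x_1,\dots,x_n]$, i.e. $I=(f_1,\dots,f_s)$ where $f_1,\dots,f_s\in k[x_1,\dots,x_n]$ are homogeneous polynomials (possibly of different degrees). Then for every integer $m\ge 0$ the $m$-th jet closure of $I$ is $$I^{m\text{-}jc}=I+\mathfrak m^{m+1}.$$
   Context: $k$ is an algebraically closed field of characteristic $0$. For an integer $m\ge 0$ put $P_m=k[x_i^{(j)}: 1\le i\le n,\ 1\le j\le m]$. For $g\in R=k[[x_1,\dots,x_n]]$ define $D_0(g),\dots,D_m(g)\in P_m$ by $$g\Big(\sum_{j=1}^m x_1^{(j)}t^j,\dots,\sum_{j=1}^m x_n^{(j)}t^j\Big)\equiv\sum_{j=0}^m D_j(g)\,t^j \pmod{t^{m+1}}.$$ For an ideal $I\subset R$ let $\overline{I}_m\subset P_m$ be the ideal generated by all $D_j(g)$ with $g\in I$, $0\le j\le m$. (Here $P_m$ is the $m$-th jet ring $R_m$ modulo $\mathfrak m R_m$, and $\overline I_m$ is the image of the $m$-th jet ideal of $I$.) The $m$-th jet closure of $I$ is $$I^{m\text{-}jc}=\{f\in R: D_j(f)\in \overline I_m \text{ for all } 0\le j\le m\}.$$ *)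

(* Defs.v *)
From HB Require Import structures.
From mathcomp Require Import all_boot all_order all_algebra.
From mathcomp Require Import boolp classical_sets.
From mathcomp Require Import mpoly.

Set Implicit Arguments.
Unset Strict Implicit.
Unset Printing Implicit Defensive.

Import GRing.Theory.
Local Open Scope ring_scope.
Local Open Scope classical_set_scope.

(* {mpseries R[n]} is the ring R[[x_1, ..., x_n]]: a series is the function
   sending an exponent vector to its coefficient.  It is wrapped in a record so
   that the ring structure is the Cauchy product and not the pointwise one. *)
Record mpseries (n : nat) (R : nzRingType) :=
  MPSeries { mpscoef :> 'X_{1..n} -> R }.

Notation "{ 'mpseries' R [ n ] }" := (mpseries n R)
  (at level 0, R at level 2, n at level 2,
   format "{ 'mpseries'  R [ n ] }") : type_scope.

HB.instance Definition _ (n : nat) (R : nzRingType) :=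
  gen_eqMixin {mpseries R[n]}.
HB.instance Definition _ (n : nat) (R : nzRingType) :=
  gen_choiceMixin {mpseries R[n]}.

Section MPSeriesZmodule.
Context (n : nat) (R : nzRingType).
Implicit Types f g h : {mpseries R[n]}.

Lemma mpseriesP f g : f =1 g -> f = g.
Proof. by case: f g => [f] [g] /= /funext ->. Qed.

Definition mps_zero : {mpseries R[n]} := MPSeries (fun _ => 0).
Definition mps_opp f : {mpseries R[n]} := MPSeries (fun a => - f a).
Definition mps_add f g : {mpseries R[n]} := MPSeries (fun a => f a + g a).

Fact mps_addA : associative mps_add.
Proof. by move=> f g h; apply: mpseriesP => a /=; rewrite addrA. Qed.
Fact mps_addC : commutative mps_add.
Proof. by move=> f g; apply: mpseriesP => a /=; rewrite addrC. Qed.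
Fact mps_add0 : left_id mps_zero mps_add.
Proof. by move=> f; apply: mpseriesP => a /=; rewrite add0r. Qed.
Fact mps_addN : left_inverse mps_zero mps_opp mps_add.
Proof. by move=> f; apply: mpseriesP => a /=; rewrite addNr. Qed.

HB.instance Definition _ := GRing.isZmodule.Build {mpseries R[n]}
  mps_addA mps_addC mps_add0 mps_addN.

Definition mps_of_poly (p : {mpoly R[n]}) : {mpseries R[n]} :=
  MPSeries (fun a => p@_a).

End MPSeriesZmodule.

Section MPSeriesRing.
Context (n : nat) (R : comNzRingType).
Implicit Types (f g h : {mpseries R[n]}) (p q : {mpoly R[n]}).

Definition mps_one : {mpseries R[n]} :=
  MPSeries (fun a => (a == 0%MM)%:R).

Definition mps_mul f g : {mpseries R[n]} := MPSeries (fun a =>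
  \sum_(b : 'X_{1..n < (mdeg a).+1, (mdeg a).+1} | a == (b.1 + b.2)%MM)
     f b.1 * g b.2).

Let trunc d f : {mpoly R[n]} :=
  \sum_(a : 'X_{1..n < d}) f a *: 'X_[a].

Let truncE d f a : (mdeg a < d)%N -> (trunc d f)@_a = f a.
Proof.
move=> ad; rewrite /trunc raddf_sum /= (bigD1 (BMultinom ad)) //=.
rewrite mcoeffZ mcoeffX eqxx mulr1 big1 ?addr0 // => b nab.
rewrite mcoeffZ mcoeffX -(inj_eq val_inj) /= in nab *.
by rewrite (negbTE nab) mulr0.
Qed.

Let mulE d f g p q a : (mdeg a < d)%N ->
  (forall b, (mdeg b < d)%N -> p@_b = f b) ->
  (forall b, (mdeg b < d)%N -> q@_b = g b) ->
  (p * q)@_a = mps_mul f g a.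
Proof.
move=> ad pf qg; rewrite mcoeffM; apply: eq_bigr => -[b c] /= _.
by rewrite pf ?qg //; [move: (bmdeg c)|move: (bmdeg b)] => h;
   apply: (leq_trans h).
Qed.

Fact mps_mulC : commutative mps_mul.
Proof.
move=> f g; apply: mpseriesP => a; pose d := (mdeg a).+1.
rewrite -(mulE (ltnSn _) (@truncE d f) (@truncE d g)).
by rewrite -(mulE (ltnSn _) (@truncE d g) (@truncE d f)) mulrC.
Qed.

Fact mps_mulA : associative mps_mul.
Proof.
move=> f g h; apply: mpseriesP => a; pose d := (mdeg a).+1.
have M u v b : (mdeg b < d)%N ->
    (trunc d u * trunc d v)@_b = mps_mul u v b.
  by move=> bd; apply: (mulE bd); apply: truncE.
rewrite -(mulE (ltnSn _) (@truncE d f) (M g h)).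
by rewrite -(mulE (ltnSn _) (M f g) (@truncE d h)) mulrA.
Qed.

Fact mps_mul1 : left_id mps_one mps_mul.
Proof.
move=> f; apply: mpseriesP => a; pose d := (mdeg a).+1.
rewrite -(mulE (p := 1) (ltnSn _) _ (@truncE d f)) ?mul1r ?truncE //.
by move=> b _; rewrite mcoeff1.
Qed.

Fact mps_mulDl : left_distributive mps_mul +%R.
Proof.
move=> f g h; apply: mpseriesP => a /=; rewrite -big_split /=.
by apply: eq_bigr => b _; rewrite mulrDl.
Qed.

Fact mps_oner_neq0 : mps_one != 0.
Proof.
apply/eqP => /(congr1 (fun f : {mpseries R[n]} => f 0%MM)) /eqP.
by rewrite /= eqxx oner_eq0.
Qed.

HB.instance Definition _ := GRing.Zmodule_isComNzRing.Build {mpseries R[n]}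
  mps_mulA mps_mulC mps_mul1 mps_mulDl mps_oner_neq0.

Definition mps_maximal_ideal : set {mpseries R[n]} :=
  [set f | f 0%MM = 0].

End MPSeriesRing.

Section Ideals.
Context (A : comNzRingType).
Implicit Types (S I J : set A).

Definition is_ideal I : Prop :=
  [/\ I 0, (forall x y, I x -> I y -> I (x + y)) &
      (forall a x, I x -> I (a * x))].

Definition ideal_gen S : set A := smallest is_ideal S.

Definition ideal_add I J : set A := [set x + y | x in I & y in J].

Definition ideal_mul I J : set A := ideal_gen [set x * y | x in I & y in J].

Definition ideal_exp I (e : nat) : set A := iter e (ideal_mul I) setT.

End Ideals.

Section Jets.
Context (n : nat) (k : comNzRingType) (m : nat).

(* The variable x_i^{(j)}, 1 <= j <= m, is 'X_(mxvec_index i j') where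
   j' : 'I_m has value j - 1. *)
Local Notation jet_ring := {mpoly k[n * m]}.

Definition jet_var (i : 'I_n) (j : 'I_m) : jet_ring := 'X_(mxvec_index i j).

Definition jet_arc (i : 'I_n) : {poly jet_ring} :=
  \sum_(j < m) (jet_var i j)%:P * 'X^(j.+1).

Definition jet_subst (d : nat) (g : {mpseries k[n]}) : {poly jet_ring} :=
  \sum_(a : 'X_{1..n < d}) ((g a)%:MP)%:P * \prod_(i < n) jet_arc i ^+ a i.

(* Each arc is divisible by t, so modulo t^(m+1) the monomials of degree > m do
   not contribute to the substitution (see jet_subst_stable). *)
Definition jet_coef (j : nat) (g : {mpseries k[n]}) : jet_ring :=
  (jet_subst m.+1 g)`_j.

Definition jet_ideal (I : set {mpseries k[n]}) : set jet_ring :=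
  ideal_gen [set h | exists2 g, I g & exists2 j, (j <= m)%N & h = jet_coef j g].

Definition jet_closure (I : set {mpseries k[n]}) : set {mpseries k[n]} :=
  [set f | forall j, (j <= m)%N -> jet_ideal I (jet_coef j f)].

Lemma jet_subst_stable (d j : nat) (g : {mpseries k[n]}) :
  (m < d)%N -> (j <= m)%N -> (jet_subst d g)`_j = jet_coef j g.
Proof.
move=> md jm.
have arcX i : exists q, jet_arc i = q * 'X.
  exists (\sum_(j < m) (jet_var i j)%:P * 'X^j).
  by rewrite mulr_suml; apply: eq_bigr => l _; rewrite exprSr mulrA.
have monX (a : 'X_{1..n}) :
    exists q, \prod_(i < n) jet_arc i ^+ a i = q * 'X^(mdeg a).
  have [q qE] := choice arcX; exists (\prod_(i < n) q i ^+ a i).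
  rewrite mdegE -prodrXr -big_split /=.
  by apply: eq_bigr => i _; rewrite qE exprMn_comm; last exact: mulrC.
pose F (a : 'X_{1..n}) :=
  (((g a)%:MP)%:P * \prod_(i < n) jet_arc i ^+ a i : {poly jet_ring})`_j.
have F0 a : (m < mdeg a)%N -> F a = 0.
  move=> ma; rewrite /F; have [q ->] := monX a.
  by rewrite mulrA coefMXn (leq_ltn_trans jm ma).
have widen e : \sum_(a : 'X_{1..n < e}) F a =
    \sum_(a : 'X_{1..n < e} | (mdeg a <= m)%N) F a.
  rewrite [RHS]big_mkcond; apply: eq_bigr => a _.
  by case: leqP => // /F0.
rewrite /jet_coef /jet_subst !coef_sum -!/(F _) (widen d).
pose w (a : 'X_{1..n < m.+1}) : 'X_{1..n < d} :=
  BMultinom (leq_trans (bmdeg a) md).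
rewrite (reindex_omap w (fun a => insub (val a))) /=; last first.
  move=> a am; rewrite insubT /=; congr Some; exact: val_inj.
apply: eq_bigl => a; rewrite -ltnS bmdeg /=.
by rewrite insubT ?bmdeg //= => h; apply/eqP; congr Some; apply: val_inj.
Qed.

End Jets.

(* Main.v *)
Require Import Defs.
From mathcomp Require Import all_boot all_order all_algebra.
From mathcomp Require Import boolp classical_sets.
From mathcomp Require Import mpoly.
From HB Require Import structures.

Set Implicit Arguments.
Unset Strict Implicit.
Unset Printing Implicit Defensive.

Import GRing.Theory.
Local Open Scope ring_scope.
Local Open Scope classical_set_scope.

(** Restrict jets to the straight arcs: the ring morphism [jet_line] sends
    x_i^(1) to x_i and x_i^(j) to 0 for j > 1, so it turns the substitution
    g(x^(1) t + x^(2) t^2 + ...) into g(x t) modulo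
    t^(m + 1).  The coefficient of t^j in g(x t) is the homogeneous component of
    g of degree j; hence [jet_line] sends D_j(g) to that component for every
    series g and j <= m ([jet_line_coef]).

    Since I is generated by homogeneous polynomials, it contains the homogeneous
    components of all its elements ([ideal_gen_homog]).  So [jet_line] sends the
    generators D_j(g), g in I, of the jet ideal into I, and therefore the whole
    jet ideal into I.  If f is in the jet closure, then D_j(f) is in the jet
    ideal for all j <= m, so the components of f of degree at most m are in I.
    What remains of f is a series of order at least m + 1, and the series of
    order at least m + 1 form the power m + 1 of the maximal ideal
    ([ideal_exp_maximalE]).

    Conversely the D_j are additive, they send I into the jet ideal by
    definition, and they vanish for j <= m on series of order at least m + 1. *)

(** * Ideals *)

Section IdealTheory.
Context (A : comNzRingType).
Implicit Types (S I : set A).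

Lemma ideal_gen_is_ideal S : is_ideal (ideal_gen S).
Proof.
split=> [J [[]] //|x y Sx Sy J JS|a x Sx J JS].
- by case: (JS) => -[_ JD _] _; apply: JD; [apply: Sx|apply: Sy].
- by case: (JS) => -[_ _ JM] _; apply: JM; apply: Sx.
Qed.

Lemma ideal_gen_incl S : S `<=` ideal_gen S.
Proof. exact: sub_gen_smallest. Qed.

Lemma ideal_gen_min S I : is_ideal I -> S `<=` I -> ideal_gen S `<=` I.
Proof. exact: smallest_sub. Qed.

Lemma ideal_sum {I} (idI : is_ideal I) (T : Type) (r : seq T) (P : pred T)
    (F : T -> A) :
  (forall i, P i -> I (F i)) -> I (\sum_(i <- r | P i) F i).
Proof. by case: idI => I0 ID _ FI; elim/big_ind: _. Qed.

End IdealTheory.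

Lemma ideal_preim (A B : comNzRingType) (h : {rmorphism A -> B}) (I : set B) :
  is_ideal I -> is_ideal (h @^-1` I).
Proof.
case=> I0 ID IM; split=> [|x y Ix Iy|a x Ix] /=.
- by rewrite rmorph0.
- by rewrite rmorphD; apply: ID.
- by rewrite rmorphM; apply: IM.
Qed.

(** * Order and homogeneous components of power series *)

Section Series.
Context (n : nat) (k : comNzRingType).
Implicit Types (f g : {mpseries k[n]}) (a b : 'X_{1..n}).

Lemma mpsD f g a : (f + g) a = f a + g a. Proof. by []. Qed.

Lemma mpsB f g a : (f - g) a = f a - g a. Proof. by []. Qed.

Lemma mps_sum (T : Type) (r : seq T) (P : pred T)
    (F : T -> {mpseries k[n]}) a :
  (\sum_(i <- r | P i) F i) a = \sum_(i <- r | P i) F i a.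
Proof. by elim/big_rec2: _ => //= i y x _ <-. Qed.

Lemma mps_of_poly_zmod_morphism : zmod_morphism (@mps_of_poly n k).
Proof. by move=> p q; apply: mpseriesP => a /=; rewrite mcoeffB. Qed.

Lemma mps_of_poly_monoid_morphism : monoid_morphism (@mps_of_poly n k).
Proof.
split=> [|p q]; apply: mpseriesP => a /=; first by rewrite mcoeff1.
by rewrite mcoeffM.
Qed.

HB.instance Definition _ := GRing.isZmodMorphism.Build _ _
  (@mps_of_poly n k) mps_of_poly_zmod_morphism.
HB.instance Definition _ := GRing.isMonoidMorphism.Build _ _
  (@mps_of_poly n k) mps_of_poly_monoid_morphism.

Lemma mpsXM i f a :
  (mps_of_poly 'X_i * f) a = if a i == 0%N then 0 else f (a - U_(i))%MM.
Proof.
rewrite /GRing.mul /=; case: eqVneq => ai.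
  rewrite big1 // => -[b c] /= /eqP aE; rewrite mcoeffX; case: eqVneq => bE.
    by have : a i != 0%N; [rewrite aE -bE mnmDE mnm1E eqxx|rewrite ai].
  by rewrite mul0r.
have Ua : (U_(i) <= a)%MM by rewrite lep1mP.
have d1 : (mdeg U_(i) < (mdeg a).+1)%N.
  by rewrite ltnS mdeg1 -(submK Ua) mdegD mdeg1 addn1.
have d2 : (mdeg (a - U_(i))%MM < (mdeg a).+1)%N.
  by rewrite ltnS -{2}(submK Ua) mdegD leq_addr.
rewrite (bigD1 (BMultinom d1, BMultinom d2)) /=; last by rewrite addmC submK.
rewrite mcoeffX eqxx mul1r big1 ?addr0 // => -[b c] /= /andP[/eqP aE].
rewrite mcoeffX; case: (eqVneq U_(i)%MM (bmnm b)) => bE; last first.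
  by rewrite mul0r.
case/eqP; congr pair; apply: val_inj => //=.
by have /= -> := congr1 (fun x => x - U_(i))%MM aE; rewrite -bE addmC addmK.
Qed.

(** A definition by coefficients of the d-th power of the maximal ideal; see
    [ideal_exp_maximalE]. *)
Definition mps_order_ge d : set {mpseries k[n]} :=
  [set f | forall a, (mdeg a < d)%N -> f a = 0].

Lemma mps_order_ge_ideal d : is_ideal (mps_order_ge d).
Proof.
split=> [|f g f0 g0|f g g0] //= a ad; first by rewrite mpsD f0 ?g0 ?addr0.
rewrite /GRing.mul /= big1 // => -[b c] /= /eqP aE.
rewrite g0 ?mulr0 //; apply: leq_ltn_trans ad.
by rewrite [leqRHS](congr1 mdeg aE) mdegD leq_addl.
Qed.

Lemma mps_order_ge_mul d e f g :
  mps_order_ge d f -> mps_order_ge e g -> mps_order_ge (d + e) (f * g).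
Proof.
move=> fd ge a ade; rewrite /GRing.mul /= big1 // => -[b c] /= /eqP aE.
have [bd|db] := ltnP (mdeg b) d; first by rewrite fd ?mul0r.
rewrite ge ?mulr0 // -(ltn_add2l d); apply: leq_ltn_trans ade.
by rewrite [leqRHS](congr1 mdeg aE) mdegD leq_add2r.
Qed.

(** Every nonconstant monomial is charged to one of the variables dividing it,
    and the monomials charged to x_i are collected in x_i * g_i.  This is what
    places a series of order at least d + 1 in the product of the maximal ideal
    with the series of order at least d, with only finitely many summands. *)
Lemma mps_order_geS d f : mps_order_ge d.+1 f ->
  exists2 g : 'I_n -> {mpseries k[n]}, forall i, mps_order_ge d (g i) &
    f = \sum_i mps_of_poly 'X_i * g i.
Proof.
move=> fd; pose var a := [pick i | a i != 0%N].
exists (fun i => MPSeries (fun b : 'X_{1..n} =>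
  if var (b + U_(i))%MM == Some i then f (b + U_(i))%MM else 0)).
  by move=> i a ad /=; rewrite fd ?if_same // mdegD mdeg1 addn1.
apply: mpseriesP => a; rewrite mps_sum.
under eq_bigr => i _.
  rewrite mpsXM /=.
  have -> : (if a i == 0%N then 0 else
      if var (a - U_(i) + U_(i))%MM == Some i
      then f (a - U_(i) + U_(i))%MM else 0)
      = if var a == Some i then f a else 0.
    case: eqVneq => ai; last by rewrite submK // lep1mP.
    case: eqP => //; rewrite /var; case: pickP => // j aj [ij].
    by rewrite ij ai in aj.
  over.
rewrite -big_mkcond /= /var; case: pickP => [i _|a0].
  by rewrite (big_pred1 i) // => j; rewrite eq_sym (inj_eq Some_inj).
(* Only the constant monomial is charged to no variable. *)
have -> : a = 0%MM by apply/mnmP => i; move/eqP: (a0 i); rewrite mnm0E.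
by rewrite fd ?mdeg0 // big_pred0.
Qed.

Lemma ideal_exp_maximalE d :
  ideal_exp (@mps_maximal_ideal n k) d = mps_order_ge d.
Proof.
elim: d => [|d IHd]; first by rewrite eqEsubset; split=> // f _ a.
rewrite /ideal_exp iterS -/(ideal_exp _ d) IHd eqEsubset; split.
  apply: ideal_gen_min; first exact: mps_order_ge_ideal.
  move=> _ [f /= f0 [g gd <-]]; rewrite -add1n; apply: mps_order_ge_mul => //.
  by move=> a; rewrite ltnS leqn0 mdeg_eq0 => /eqP ->.
move=> f /mps_order_geS[g gd ->].
apply: (ideal_sum (ideal_gen_is_ideal _)) => i _; apply: ideal_gen_incl.
exists (mps_of_poly 'X_i); last by exists (g i).
by rewrite /mps_maximal_ideal /= mcoeffX mnm1_eq0.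
Qed.

Definition mps_homog d f : {mpseries k[n]} :=
  MPSeries (fun a => if mdeg a == d then f a else 0).

Lemma mps_homogD d f g : mps_homog d (f + g) = mps_homog d f + mps_homog d g.
Proof. by apply: mpseriesP => a /=; case: eqP; rewrite ?addr0. Qed.

Lemma mps_homogM d f g :
  mps_homog d (f * g) = \sum_(e < d.+1) mps_homog e f * mps_homog (d - e)%N g.
Proof.
apply: mpseriesP => a; rewrite mps_sum /= exchange_big /=.
case: eqVneq => ad.
  apply: eq_bigr => -[b c] /= /eqP aE.
  have dE : d = (mdeg b + mdeg c)%N by rewrite -mdegD -aE.
  have bd : (mdeg b < d.+1)%N by rewrite ltnS dE leq_addr.
  (* Only the index e = mdeg b contributes. *)
  have cE : (d - mdeg b)%N = mdeg c by rewrite dE addKn.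
  rewrite (bigD1 (Ordinal bd)) //= eqxx cE eqxx.
  rewrite big1 ?addr0 // => e; rewrite -val_eqE /= eq_sym => /negbTE ->.
  by rewrite mul0r.
rewrite big1 // => -[b c] /= /eqP aE; rewrite big1 // => e _.
case: eqP => be; last by rewrite mul0r.
case: eqP => ce; last by rewrite mulr0.
have : mdeg a = d by rewrite (congr1 mdeg aE) mdegD be ce subnKC // -ltnS.
by move/eqP; rewrite (negbTE ad).
Qed.

Lemma mps_homog_of_poly d e (p : {mpoly k[n]}) : p \is e.-homog ->
  mps_homog d (mps_of_poly p) = if e == d then mps_of_poly p else 0.
Proof.
move=> /dhomogP pe; apply: mpseriesP => a /=.
have [pa|/memN_msupp_eq0 pa] := boolP (a \in msupp p); last first.
  by rewrite pa if_same; case: ifP.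
by rewrite (pe a pa) //; case: ifP.
Qed.

Lemma mps_homog_tail m f :
  mps_order_ge m.+1 (f - \sum_(d < m.+1) mps_homog d f).
Proof.
move=> a am; rewrite mpsB mps_sum (bigD1 (Ordinal am)) //= eqxx.
rewrite big1 ?addr0 ?subrr // => d; rewrite -val_eqE /= eq_sym.
by move=> /negbTE ->.
Qed.

(** The series all of whose homogeneous components lie in the ideal I generated
    by the p i form an ideal: the component of degree d of f * g is a
    combination of components of g ([mps_homogM]).  This ideal contains each
    p i, whose components are p i itself and 0, hence it contains I. *)
Lemma ideal_gen_homog (T : Type) (p : T -> {mpoly k[n]}) :
  (forall i, exists e, p i \is e.-homog) ->
  forall d g, ideal_gen (range (fun i => mps_of_poly (p i))) g ->
  ideal_gen (range (fun i => mps_of_poly (p i))) (mps_homog d g).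
Proof.
move=> ph d g Ig; set I := ideal_gen _.
have idI : is_ideal I by apply: ideal_gen_is_ideal.
case: (idI) => I0 ID IM.
suff : ideal_gen (range (fun i => mps_of_poly (p i)))
    `<=` [set g | forall d, I (mps_homog d g)] by apply.
apply: ideal_gen_min; last first.
  move=> _ [i _ <-] e /=; have [e' pe] := ph i.
  rewrite (mps_homog_of_poly _ pe); case: ifP => // _.
  by apply: ideal_gen_incl; exists i.
split=> [e|f h If Ih e|f h Ih e] /=.
- suff -> : mps_homog e 0 = 0 by [].
  by apply: mpseriesP => a /=; rewrite if_same.
- by rewrite mps_homogD; apply: ID.
- by rewrite mps_homogM; apply: (ideal_sum idI) => l _; apply: IM; apply: Ih.
Qed.

End Series.

(** * Specialization of jets to straight arcs *)

Section JetSpecialization.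
Context (n m : nat) (k : comNzRingType).
Implicit Types (f g : {mpseries k[n]}).

Lemma jet_substD d f g :
  jet_subst m d (f + g) = jet_subst m d f + jet_subst m d g.
Proof.
rewrite /jet_subst -big_split.
by apply: eq_bigr => a _; rewrite mpsD mpolyCD polyCD mulrDl.
Qed.

Lemma jet_coefD j f g : jet_coef m j (f + g) = jet_coef m j f + jet_coef m j g.
Proof. by rewrite /jet_coef jet_substD coefD. Qed.

Lemma jet_coef_order_ge j f : mps_order_ge m.+1 f -> jet_coef m j f = 0.
Proof.
move=> f0; rewrite /jet_coef /jet_subst big1 ?coef0 // => a _.
by rewrite f0 ?bmdeg // !rmorph0 mul0r.
Qed.

(** The morphism to k[x] sending x_i^(1) to x_i and x_i^(j) to 0 for j > 1,
    followed by the inclusion of k[x] in k[[x]].  The index j : 'I_m stands for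
    the exponent j + 1, and [mxvec] transports the values, given as a matrix, to
    the flattened indices of the jet variables. *)
Definition jet_line : {mpoly k[n * m]} -> {mpseries k[n]} :=
  @mps_of_poly n k \o mmap (@mpolyC n k)
    (mxvec (\matrix_(i < n, j < m) if j == 0%N :> nat then 'X_i else 0) 0).

HB.instance Definition _ := GRing.RMorphism.on jet_line.

Lemma jet_line_var i (j : 'I_m) :
  jet_line (jet_var k i j) = if j == 0%N :> nat then mps_of_poly 'X_i else 0.
Proof.
rewrite /jet_line /jet_var /= mmapX mmap1U mxvecE mxE.
by case: ifP; rewrite ?rmorph0.
Qed.

Lemma jet_lineC (c : k) : jet_line c%:MP = mps_of_poly c%:MP.
Proof. by rewrite /jet_line /= mmapC. Qed.

(** For m = 0 the arc is 0 and the formula fails: there is no variable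
    x_i^(1). *)
Lemma jet_line_arc i : (0 < m)%N ->
  map_poly jet_line (jet_arc k m i) = (mps_of_poly 'X_i)%:P * 'X.
Proof.
move=> m0; rewrite /jet_arc rmorph_sum (bigD1 (Ordinal m0)) //=.
rewrite big1 => [|j]; rewrite rmorphM /= map_polyC /= jet_line_var /=.
  by rewrite map_polyX addr0.
by rewrite -val_eqE /= => /negbTE ->; rewrite mul0r.
Qed.

(** Along the arc x t the monomial x^a becomes x^a t^|a|, so the coefficient of
    t^j collects the monomials of degree j. *)
Lemma jet_line_coef j g : (j <= m)%N ->
  jet_line (jet_coef m j g) = mps_homog j g.
Proof.
move=> jm; rewrite /jet_coef -coef_map /jet_subst rmorph_sum /= coef_sum.
have monE (a : 'X_{1..n < m.+1}) : map_poly jet_line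
    (((g a)%:MP)%:P * \prod_(i < n) jet_arc k m i ^+ a i)
    = (mps_of_poly ((g a)%:MP * 'X_[a]))%:P * 'X^(mdeg a).
  rewrite rmorphM /= map_polyC /= jet_lineC rmorphM polyCM -mulrA.
  congr (_ * _).
  rewrite mpolyXE_id !rmorph_prod mdegE -prodrXr -big_split /=.
  apply: eq_bigr => i _; rewrite !rmorphXn /= -exprMn.
  (* If m = 0, then a = 0, and the arc, which is 0, occurs to the power 0. *)
  have [->|ai] := eqVneq (a i) 0%N; first by rewrite !expr0.
  have am : (mdeg a <= m)%N by rewrite -ltnS bmdeg.
  rewrite jet_line_arc //; apply: leq_trans am.
  by rewrite lt0n mdeg_eq0; apply: contra_neq ai => ->; rewrite mnm0E.
under eq_bigr => a _ do rewrite monE coefMXn.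
apply: mpseriesP => c; rewrite mps_sum /=.
have termE (a : 'X_{1..n < m.+1}) :
    ((if (j < mdeg a)%N then 0
      else ((mps_of_poly ((g a)%:MP * 'X_[a]))%:P)`_(j - mdeg a))
      : {mpseries k[n]}) c
    = if (a == c :> 'X_{1..n}) && (mdeg a == j) then g a else 0.
  rewrite coefC subn_eq0; case: ltngtP => //= [_|_|_]; rewrite ?andbF ?andbT //.
  by rewrite mcoeffCM mcoeffX; case: eqP; rewrite ?mulr1 ?mulr0.
under eq_bigr => a _ do rewrite termE.
rewrite -big_mkcond /=; case: eqVneq => [cj|cj].
  have cm : (mdeg c < m.+1)%N by rewrite cj ltnS.
  rewrite (big_pred1 (BMultinom cm)) // => a /=.
  rewrite -[RHS](inj_eq (val_inj : injective (@bmnm n m.+1))) /=.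
  by case: eqVneq => //= ->; rewrite cj eqxx.
by rewrite big_pred0 // => a; case: eqVneq => //= ->; apply: negbTE.
Qed.

End JetSpecialization.

(** * Jet closures of homogeneous ideals *)

Theorem theoremA (k : closedFieldType) (hk : [pchar k] =i pred0)
    (n s : nat) (f : 'I_s -> {mpoly k[n]})
    (hf : forall i, exists d, f i \is d.-homog)
    (I : set {mpseries k[n]})
    (hI : I = ideal_gen (range (fun i => mps_of_poly (f i))))
    (m : nat) :
  jet_closure m I =
    ideal_add I (ideal_exp (@mps_maximal_ideal n k) m.+1).
Proof.
rewrite ideal_exp_maximalE; have idI : is_ideal I.
  by rewrite hI; apply: ideal_gen_is_ideal.
rewrite eqEsubset; split=> [g gI|_ [x Ix [y /= y0 <-]] j jm]; last first.
  rewrite jet_coefD (jet_coef_order_ge j y0) addr0.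
  by apply: ideal_gen_incl; exists x => //; exists j.
exists (\sum_(d < m.+1) mps_homog d g); last first.
  by exists (g - \sum_(d < m.+1) mps_homog d g);
    [exact: mps_homog_tail|rewrite addrC subrK].
apply: (ideal_sum idI) => d _; have dm : (d <= m)%N by rewrite -ltnS.
rewrite -(jet_line_coef _ dm).
suff : jet_ideal I `<=` @jet_line n m k @^-1` I by apply; apply: gI.
apply: ideal_gen_min; first exact: ideal_preim.
move=> _ [x Ix [j jm ->]]; rewrite /preimage /= jet_line_coef //.
by move: Ix; rewrite hI; apply: ideal_gen_homog.
Qed.
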